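(* The map $[-1,1]\to\{\bullet\}$ from the closed interval to the one-point space belongs to the class $$\{\mathsf M\to\mathsf\Lambda,\ \ \mathsf\Lambda\to\{\bullet\}\}^{lr}.$$
   Context: The class is computed in the category of all topological spaces and continuous maps. $\mathsf\Lambda=\{a\leftarrow o\to b\}$ is the three-point space with one open point $o$ and two closed points $a,b$ (open sets $\emptyset,\{o\},\{a,o\},\{o,b\},\{a,o,b\}$). $\mathsf M=\{a\leftarrow u\to x\leftarrow v\to b\}$ is the five-point space whose topology is generated by the open sets $\{u\},\{v\},\{a,u\},\{u,x,v\},\{v,b\}$. The map $\mathsf M\to\mathsf\Lambda$ sends $a\mapsto a$, $b\mapsto b$ and $u,x,v\mapsto o$. For maps $f:A\to B$, $g:X\to Y$, $f\pitchfork g$ means: for all $t:A\to X$, $s:B\to Y$ with $g\circ t=s\circ f$ there is $h:B\to X$ with $h\circ f=t$ and $g\circ h=s$. For a class $P$ of maps, $P^l=\{f:\ f\pitchfork g \text{ for all } g\in P\}$, $P^r=\{g:\ f\pitchfork g\text{ for all } f\in P\}$, $P^{lr}=(P^l)^r$. *)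

(* Defs.v *)
From HB Require Import structures.
From mathcomp Require Import all_boot all_order all_algebra finmap.
From mathcomp Require Import all_classical all_reals all_analysis.

Set Implicit Arguments.
Unset Strict Implicit.
Unset Printing Implicit Defensive.
Import Order.TTheory GRing.Theory Num.Theory.
Import numFieldNormedType.Exports.

Local Open Scope classical_set_scope.
Local Open Scope ring_scope.

(* The objects of [topologicalType] need not be nonempty or separated, and the
   choice structure they carry exists on every type classically: this is the
   category of all topological spaces, with [continuousType] as morphisms. *)
Definition map_class := forall X Y : topologicalType, continuousType X Y -> Prop.

(* [lifts f g] is the relation written f ⋔ g. *)
Definition lifts (A B X Y : topologicalType)
    (f : continuousType A B) (g : continuousType X Y) : Prop :=
  forall (t : continuousType A X) (s : continuousType B Y),
    g \o t = s \o f ->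
    exists h : continuousType B X, h \o f = t /\ g \o h = s.

(* P^l, then P^r. *)
Definition left_orth (P : map_class) : map_class :=
  fun A B f => forall (X Y : topologicalType) (g : continuousType X Y),
    P X Y g -> lifts f g.

Definition right_orth (P : map_class) : map_class :=
  fun X Y g => forall (A B : topologicalType) (f : continuousType A B),
    P A B f -> lifts f g.

(* The space a <- o -> b. *)
Inductive Lambda : Type := La | Lo | Lb.

HB.instance Definition _ := gen_eqMixin Lambda.
HB.instance Definition _ := gen_choiceMixin Lambda.

Definition Lambda_open : set (set Lambda) :=
  [set U | U = set0 \/ U = [set Lo] \/ U = [set La; Lo] \/
           U = [set Lo; Lb] \/ U = [set La; Lo; Lb]].

Lemma Lambda_openE U : Lambda_open U <-> (U !=set0 -> U Lo).
Proof.
split=> [|UP].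
  by case=> [|[|[|[|]]]] -> [x] //=; rewrite /setU /=; tauto.
have [->|/set0P/UP Uo] := eqVneq U set0; first by left.
right; have [Ua|Ua] := pselect (U La); have [Ub|Ub] := pselect (U Lb).
- by do 3!right; apply/seteqP; split=> [[]|x] //=; rewrite /setU /=;
    [tauto|tauto|tauto|move=> [[]|] ->].
- by right; left; apply/seteqP; split=> [[]|x] //=; rewrite /setU /=;
    [tauto|tauto|move=> [] ->].
- by do 2!right; left; apply/seteqP; split=> [[]|x] //=; rewrite /setU /=;
    [tauto|tauto|move=> [] ->].
- by left; apply/seteqP; split=> [[]|x ->].
Qed.

Lemma Lambda_openT : Lambda_open setT.
Proof. exact/Lambda_openE. Qed.

Lemma Lambda_openI : setI_closed Lambda_open.
Proof.
move=> U V /Lambda_openE UP /Lambda_openE VP; apply/Lambda_openE => -[x [Ux Vx]].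
by split; [apply: UP; exists x|apply: VP; exists x].
Qed.

Lemma Lambda_open_bigU (I : Type) (f : I -> set Lambda) :
  (forall i, Lambda_open (f i)) -> Lambda_open (\bigcup_i f i).
Proof.
move=> fP; apply/Lambda_openE => -[x [i _ fx]].
by exists i => //; move/Lambda_openE: (fP i); apply; exists x.
Qed.

HB.instance Definition _ := isOpenTopological.Build Lambda
  Lambda_openT Lambda_openI Lambda_open_bigU.

(* The space a <- u -> x <- v -> b. *)
Inductive Mspace : Type := Ma | Mu | Mx | Mv | Mb.

HB.instance Definition _ := gen_eqMixin Mspace.
HB.instance Definition _ := gen_choiceMixin Mspace.

Definition M_subbase : set (set Mspace) :=
  [set U | U = [set Mu] \/ U = [set Mv] \/ U = [set Ma; Mu] \/
           U = [set Mu; Mx; Mv] \/ U = [set Mv; Mb]].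

HB.instance Definition _ :=
  isSubBaseTopological.Build Mspace M_subbase (@id (set Mspace)).

Definition M_to_Lambda_fun (m : Mspace) : Lambda :=
  match m with
  | Ma => La
  | Mb => Lb
  | Mu | Mx | Mv => Lo
  end.

Lemma M_subbase_open U : M_subbase U -> open U.
Proof.
move=> MU; exists [set U]; last by rewrite bigcup_set1.
move=> _ ->; exists [fset U]%fset.
  by move=> V /fset1P ->; rewrite inE.
by rewrite set_fset1 bigcap_set1.
Qed.

Lemma M_to_Lambda_continuous : continuous M_to_Lambda_fun.
Proof.
have ou : open [set Mu; Mx; Mv] by apply: M_subbase_open; rewrite /M_subbase/=; tauto.
have oa : open [set Ma; Mu] by apply: M_subbase_open; rewrite /M_subbase/=; tauto.
have ob : open [set Mv; Mb] by apply: M_subbase_open; rewrite /M_subbase/=; tauto.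
apply/continuousP => _ [|[|[|[|]]]] ->.
- by rewrite preimage_set0; exact: open0.
- suff -> : M_to_Lambda_fun @^-1` [set Lo] = [set Mu; Mx; Mv] by [].
  by apply/seteqP; split=> -[] /=; rewrite /setU /=; intuition discriminate.
- suff -> : M_to_Lambda_fun @^-1` [set La; Lo] = [set Ma; Mu] `|` [set Mu; Mx; Mv].
    exact: openU.
  by apply/seteqP; split=> -[] /=; rewrite /setU /=; intuition discriminate.
- suff -> : M_to_Lambda_fun @^-1` [set Lo; Lb] = [set Mu; Mx; Mv] `|` [set Mv; Mb].
    exact: openU.
  by apply/seteqP; split=> -[] /=; rewrite /setU /=; intuition discriminate.
- suff -> : M_to_Lambda_fun @^-1` [set La; Lo; Lb] = setT by exact: openT.
  by apply/seteqP; split=> -[] /=; rewrite /setU /=; intuition discriminate.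
Qed.

Definition M_to_Lambda : continuousType Mspace Lambda :=
  mkcts M_to_Lambda_continuous.

Definition one_point : topologicalType := discrete_topology unit.
Definition to_point (X : topologicalType) : continuousType X one_point := cst tt.

(* The two-element class {M -> Lambda, Lambda -> pt}. *)
Inductive M_Lambda_class : map_class :=
| M_Lambda_class_M : M_Lambda_class M_to_Lambda
| M_Lambda_class_L : M_Lambda_class (to_point Lambda).

(* [set_type A] carries the subspace topology, unlike [subspace A]. *)
Definition segment (R : realType) : topologicalType :=
  set_type (`[-1, 1]%classic : set R).

(* Main.v *)
(** A map to Lambda is a pair of opens covering the source, and a lift through
    M -> Lambda inserts disjoint opens P, Q such that V, P and U, Q still cover.
    So, given f in the left class and t : A -> [-1, 1], lifting against
    Lambda -> pt yields opens of B that contain {h < 1} and {h > -1}, and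
    lifting against M -> Lambda bisects repeatedly, as in Urysohn's lemma: at every
    dyadic r we get disjoint opens U_r, V_r of B pulling back to {t < r} and
    {t > r}, with V_r and U_s covering B for r < s. Then
    h b = inf {r | b in U_r} is a continuous extension of t. *)

Require Import Defs.
From mathcomp Require Import all_boot all_order all_algebra.
From mathcomp Require Import all_classical all_reals all_analysis.
From mathcomp Require Import ring lra.

Set Implicit Arguments.
Unset Strict Implicit.
Unset Printing Implicit Defensive.
Import Order.TTheory GRing.Theory Num.Theory.
Import numFieldNormedType.Exports.

Local Open Scope classical_set_scope.
Local Open Scope ring_scope.

(** * Continuous maps into [Lambda] and [Mspace] *)

(* [U] and [V] are the preimages of the open sets {a, o} and {o, b}. *)
Definition Lambda_map (T : Type) (U V : set T) (x : T) : Lambda :=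
  if ~~ `[< V x >] then La else if ~~ `[< U x >] then Lb else Lo.

Lemma Lambda_map_continuous (T : topologicalType) (U V : set T) :
  open U -> open V -> (forall x, U x \/ V x) -> continuous (Lambda_map U V).
Proof.
move=> oU oV UV; apply/continuousP => _ [|[|[|[|]]]] ->.
- by rewrite preimage_set0; exact: open0.
- suff -> : Lambda_map U V @^-1` [set Lo] = U `&` V by exact: openI.
  apply/seteqP; split=> x /=; rewrite /Lambda_map;
    by case: asboolP; case: asboolP => //= ? ? [].
- suff -> : Lambda_map U V @^-1` [set La; Lo] = U by [].
  apply/seteqP; split=> x; rewrite /= /Lambda_map; have := UV x;
    by case: asboolP; case: asboolP => //=; intuition discriminate.
- suff -> : Lambda_map U V @^-1` [set Lo; Lb] = V by [].
  apply/seteqP; split=> x; rewrite /= /Lambda_map; have := UV x;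
    by case: asboolP; case: asboolP => //=; intuition discriminate.
- suff -> : Lambda_map U V @^-1` [set La; Lo; Lb] = setT by exact: openT.
  apply/seteqP; split=> x //= _.
  by case: (Lambda_map U V x); rewrite /setU /=; tauto.
Qed.

Lemma continuous_to_M (T : topologicalType) (g : T -> Mspace) :
  (forall W, M_subbase W -> open (g @^-1` W)) -> continuous g.
Proof.
move=> og; apply/continuousP => _ [D' fD' <-].
rewrite preimage_bigcup; apply: bigcup_open => _ /fD'[F FM <-].
rewrite openE => x gFx; apply: filter_bigI => W FW.
apply: open_nbhs_nbhs; split; last exact: gFx.
by apply: og; have := FM _ FW; rewrite inE.
Qed.

(* [P] and [Q] are the preimages of {a, u} and {v, b}, while [U] and [V] are as
   in [Lambda_map]. *)
Definition M_map (T : Type) (U V P Q : set T) (x : T) : Mspace :=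
  if `[< P x >] then (if `[< V x >] then Mu else Ma)
  else if `[< Q x >] then (if `[< U x >] then Mv else Mb) else Mx.

Section MMap.
Variables (T : topologicalType) (U V P Q : set T).
Hypotheses (oU : open U) (oV : open V) (oP : open P) (oQ : open Q).
Hypotheses (PQ : forall x, P x -> Q x -> False).
Hypotheses (VP : forall x, V x \/ P x) (UQ : forall x, U x \/ Q x).

(** Outside both [P] and [Q] the two coverings force [V] and [U], so the value [Mx] occurs only over
    the intersection of [U] and [V]. *)
Lemma M_map_continuous : continuous (M_map U V P Q).
Proof.
apply: continuous_to_M => _ [|[|[|[|]]]] ->.
- suff -> : M_map U V P Q @^-1` [set Mu] = P `&` V by exact: openI.
  apply/seteqP; split=> x; rewrite /= /setI /= /setU /= /M_map;
    have := VP x; have := UQ x; have := @PQ x;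
    by do !case: asboolP => //=; intuition discriminate.
- suff -> : M_map U V P Q @^-1` [set Mv] = Q `&` U by exact: openI.
  apply/seteqP; split=> x; rewrite /= /setI /= /setU /= /M_map;
    have := VP x; have := UQ x; have := @PQ x;
    by do !case: asboolP => //=; intuition discriminate.
- suff -> : M_map U V P Q @^-1` [set Ma; Mu] = P by [].
  apply/seteqP; split=> x; rewrite /= /setI /= /setU /= /M_map;
    have := VP x; have := UQ x; have := @PQ x;
    by do !case: asboolP => //=; intuition discriminate.
- suff -> : M_map U V P Q @^-1` [set Mu; Mx; Mv] = U `&` V by exact: openI.
  apply/seteqP; split=> x; rewrite /= /setI /= /setU /= /M_map;
    have := VP x; have := UQ x; have := @PQ x;
    by do !case: asboolP => //=; intuition discriminate.
- suff -> : M_map U V P Q @^-1` [set Mv; Mb] = Q by [].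
  apply/seteqP; split=> x; rewrite /= /setI /= /setU /= /M_map;
    have := VP x; have := UQ x; have := @PQ x;
    by do !case: asboolP => //=; intuition discriminate.
Qed.

End MMap.

(** * Lifting properties in terms of open sets *)

Lemma Lambda_lift_cover (A B : topologicalType) (f : continuousType A B)
    (U V : set A) :
  lifts f (to_point Lambda) -> open U -> open V -> (forall x, U x \/ V x) ->
  exists U' V' : set B, [/\ open U', open V', (forall y, U' y \/ V' y),
    (forall x, U' (f x) <-> U x) & (forall x, V' (f x) <-> V x)].
Proof.
move=> fL oU oV UV.
have [|h [hf _]] := fL (mkcts (Lambda_map_continuous oU oV UV)) (to_point B).
  by [].
have /continuousP ch : continuous h by exact: cts_fun.
have hfE x : h (f x) = Lambda_map U V x by have := congr1 (@^~ x) hf.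
exists (h @^-1` [set La; Lo]), (h @^-1` [set Lo; Lb]); split.
- by apply: ch; right; right; left.
- by apply: ch; right; right; right; left.
- by move=> y /=; case: (h y); rewrite /setU/=; tauto.
- move=> x; rewrite /= /setU/= hfE /Lambda_map; have := UV x.
  by case: asboolP; case: asboolP => //=; intuition discriminate.
- move=> x; rewrite /= /setU/= hfE /Lambda_map; have := UV x.
  by case: asboolP; case: asboolP => //=; intuition discriminate.
Qed.

(** [P] and [Q] define a map [A -> Mspace] over the map to [Lambda] given by [U] and [V]; a lift to
    [B] yields [P'] and [Q'] as preimages of {a, u} and {v, b}. *)
Lemma M_lift_separation (A B : topologicalType) (f : continuousType A B)
    (U V : set B) (P Q : set A) :
  lifts f M_to_Lambda ->
  open U -> open V -> (forall y, U y \/ V y) ->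
  open P -> open Q -> (forall x, P x -> Q x -> False) ->
  (forall x, V (f x) \/ P x) -> (forall x, U (f x) \/ Q x) ->
  exists P' Q' : set B,
    [/\ [/\ open P', open Q' & forall y, P' y -> Q' y -> False],
        (forall y, V y \/ P' y), (forall y, U y \/ Q' y),
        (forall x, P' (f x) <-> P x) & (forall x, Q' (f x) <-> Q x)].
Proof.
move=> fM oU oV UV oP oQ PQ VP UQ.
have /continuousP cf : continuous f by exact: cts_fun.
have [ofU ofV] := (cf _ oU, cf _ oV).
have [|h [hf hL]] := fM (mkcts (M_map_continuous ofU ofV oP oQ PQ VP UQ))
    (mkcts (Lambda_map_continuous oU oV UV)).
  apply/funext => x.
  change (M_to_Lambda_fun (M_map (f @^-1` U) (f @^-1` V) P Q x)
    = Lambda_map U V (f x)).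
  rewrite /M_map /Lambda_map /=.
  have := VP x; have := UQ x; have := UV (f x); have := @PQ x.
  by do !case: asboolP => //=; intuition discriminate.
have /continuousP ch : continuous h by exact: cts_fun.
have hfE x : h (f x) = M_map (f @^-1` U) (f @^-1` V) P Q x.
  by have := congr1 (@^~ x) hf.
have hLE y : M_to_Lambda_fun (h y) = Lambda_map U V y.
  by have := congr1 (@^~ y) hL.
exists (h @^-1` [set Ma; Mu]), (h @^-1` [set Mv; Mb]); split; [split| | | |].
- by apply/ch/M_subbase_open; do 2!right; left.
- by apply/ch/M_subbase_open; do 4!right.
- by move=> y [|] /= -> [].
(* Outside [V] the map to [Lambda] takes the value [La], and only [Ma] lies over it. *)
- move=> y /=; have := hLE y; rewrite /Lambda_map.
  case: asboolP; first by left.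
  by case: (h y) => //= _ _; right; left.
- move=> y /=; have := hLE y; rewrite /Lambda_map; have := UV y.
  case: asboolP; case: asboolP => //=; try tauto.
  by case: (h y) => //= *; right; right.
- move=> x; rewrite /= /setU/= hfE /M_map.
  have := VP x; have := UQ x; have := @PQ x.
  by do !case: asboolP => //=; intuition discriminate.
- move=> x; rewrite /= /setU/= hfE /M_map.
  have := VP x; have := UQ x; have := @PQ x.
  by do !case: asboolP => //=; intuition discriminate.
Qed.

(** * Dyadic subdivision of the interval *)

Definition dyadic (R : realType) (n k : nat) : R := -1 + k%:R * (2 / 2 ^+ n).

Lemma dyadic_double (R : realType) n k : dyadic R n.+1 k.*2 = dyadic R n k.
Proof.
have n0 : 2 ^+ n != 0 :> R by rewrite expf_neq0.
by rewrite /dyadic exprS -muln2 natrM; field.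
Qed.

Lemma dyadic_ltS (R : realType) n k : dyadic R n k < dyadic R n k.+1.
Proof. by rewrite /dyadic ltrD2l ltr_pM2r ?ltr_nat // divr_gt0 ?exprn_gt0. Qed.

Lemma dyadic_le (R : realType) n j k :
  (dyadic R n j <= dyadic R n k) = (j <= k)%N.
Proof. by rewrite /dyadic lerD2l ler_pM2r ?ler_nat // divr_gt0 ?exprn_gt0. Qed.

Lemma dyadic_scale (R : realType) n m k :
  dyadic R (m + n) (2 ^ m * k) = dyadic R n k.
Proof.
elim: m => [|m IH]; first by rewrite mul1n.
by rewrite addSn expnS -mulnA mul2n dyadic_double.
Qed.

(** Two neighbouring grid points are produced because [cut_lt] relates neighbouring cuts. *)
Lemma dyadic_dense (R : realType) (x y : R) : -1 <= x -> x < y ->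
  exists n k, x < dyadic R n k /\ dyadic R n k.+1 < y.
Proof.
move=> x1 xy; have yx : 0 < y - x by rewrite subr_gt0.
(* Since [n < 2 ^ n], two grid steps, of total length [4 / 2 ^ n], are shorter than [y - x]. *)
pose n := (Num.truncn (4 / (y - x))).+1.
pose d : R := 2 / 2 ^+ n.
have d0 : 0 < d by rewrite divr_gt0 ?exprn_gt0.
have dyx : d * 2 < y - x.
  have : 4 / (y - x) < 2 ^+ n.
    apply: (lt_trans (truncnS_gt _)).
    by rewrite -natrX ltr_nat; exact: ltn_expl.
  rewrite ltr_pdivrMr // => h.
  by rewrite /d mulrAC ltr_pdivrMr ?exprn_gt0 //; lra.
pose k := Num.truncn ((x + 1) / d).
have /andP[kx xk] : k%:R <= (x + 1) / d < k.+1%:R.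
  by apply: truncn_itv; rewrite divr_ge0 ?(ltW d0) //; lra.
(* Index [k.+1] gives the first grid point beyond [x]; the next one is at most [x + 2 * d]. *)
exists n, k.+1; rewrite /dyadic -/d.
move: kx xk; rewrite ler_pdivlMr // ltr_pdivrMr // -!(natr1 _) => kx xk.
by split; lra.
Qed.

(** * Urysohn-type extension of a map to the interval *)

Section Extension.
Variables (R : realType) (A B : topologicalType) (f : continuousType A B).
Variable t : A -> R.
Hypotheses (ct : continuous t) (t_itv : forall a, -1 <= t a <= 1).
Hypotheses (fL : lifts f (to_point Lambda)) (fM : lifts f M_to_Lambda).

Let t_ge a : -1 <= t a. Proof. by case/andP: (t_itv a). Qed.
Let t_le a : t a <= 1. Proof. by case/andP: (t_itv a). Qed.

Let open_t W : open W -> open (t @^-1` W).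
Proof. by move: W; apply/continuousP. Qed.

(* The pair [C] approximates the sets {h < r} and {h > r} of the extension [h],
   exactly so on the image of [f]. *)
Definition cut (r : R) (C : set B * set B) :=
  [/\ open C.1, open C.2, (forall b, C.1 b -> C.2 b -> False),
      (forall a, C.1 (f a) <-> t a < r) & (forall a, C.2 (f a) <-> r < t a)].

(** For cuts this is Urysohn's nesting: the complement of [C.2] is closed, contains [C.1] and lies
    in [D.1]. *)
Definition cut_lt (C D : set B * set B) := forall b, D.1 b \/ C.2 b.

Lemma cut_between r m s C D : r < m -> m < s ->
  cut r C -> cut s D -> cut_lt C D ->
  exists E, [/\ cut m E, cut_lt C E & cut_lt E D].
Proof.
move=> rm ms [_ oC2 _ _ fC2] [oD1 _ _ fD1 _] CD.
(* [cut_lt C D] says precisely that [D.1] and [C.2] cover [B]. *)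
have := @M_lift_separation _ _ f D.1 C.2 [set a | t a < m] [set a | m < t a] fM.
case=> //.
- exact: (open_t (@open_lt R m)).
- exact: (open_t (@open_gt R m)).
- by move=> a /= tm /(lt_trans tm); rewrite ltxx.
- move=> a /=; case: (ltP (t a) m) => mt; [by right|left].
  by apply/fC2; exact: lt_le_trans mt.
- move=> a /=; case: (ltP m (t a)) => mt; [by right|left].
  by apply/fD1; exact: le_lt_trans ms.
- move=> P [Q [[oP oQ PQ] CP DQ fP fQ]].
  exists (P, Q); split=> // b /=; first by case: (CP b); [right|left].
Qed.

(* [k] is unbounded, although [dyadic R n k] exceeds 1 for [k > 2 ^ n]: this
   saves a bound in every statement, at the cost of trivial cuts. *)
Definition scale n (C : nat -> set B * set B) :=
  forall k, cut (dyadic R n k) (C k) /\ cut_lt (C k) (C k.+1).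

Lemma scale0 : exists C, scale 0 C.
Proof.
have [||a|U [V [oU oV UV fU fV]]] :=
  @Lambda_lift_cover _ _ f [set a | t a < 1] [set a | -1 < t a] fL.
- exact: (open_t (@open_lt R 1)).
- exact: (open_t (@open_gt R (-1))).
- by rewrite /=; case: (ltP (t a) 1) => h; [left|right; lra].
(* Levels -1, 1 and beyond: nothing lies below -1 or above 1. *)
exists (fun k => match k with
  | 0 => (set0, V) | 1 => (U, set0) | _ => (setT, set0) end).
case=> [|[|k]]; split.
- split=> //=; first exact: open0.
    move=> a; split=> //; rewrite /dyadic; have := t_ge a; lra.
  by move=> a; rewrite /dyadic mul0r addr0; exact: fV.
- by move=> b /=.
- have e : dyadic R 0 1 = 1 by rewrite /dyadic expr0; lra.
  split=> //=; rewrite ?e //; first exact: open0.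
  by move=> a; split=> //; have := t_le a; lra.
- by move=> b; left.
- have e : 1 < dyadic R 0 k.+2.
    by rewrite /dyadic expr0 -!(natr1 _); have := ler0n R k; lra.
  split=> //=; [exact: openT|exact: open0| |].
    by move=> a; split=> // _; have := t_le a; lra.
  by move=> a; split=> //; have := t_le a; lra.
- by move=> b; left.
Qed.

(** New cuts go in at the midpoints, which have odd index; the old ones stay, so that a cut will
    depend only on its dyadic value. *)
Lemma scaleS n C : scale n C ->
  exists2 D, scale n.+1 D & forall k, D k.*2 = C k.
Proof.
move=> sC.
have mid k : exists E, [/\ cut (dyadic R n.+1 k.*2.+1) E,
    cut_lt (C k) E & cut_lt E (C k.+1)].
  have [[cC CC] [cC' _]] := (sC k, sC k.+1).
  apply: cut_between cC cC' CC.
    by rewrite -(dyadic_double R n k); exact: dyadic_ltS.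
  by rewrite -(dyadic_double R n k.+1); exact: dyadic_ltS.
have [E /all_and3[cE CE EC]] := choice mid.
exists (fun k => if odd k then E k./2 else C k./2); last first.
  by move=> k; rewrite odd_double doubleK.
move=> k; have := odd_double_half k; case: (boolP (odd k)) => /= ok <-.
  by rewrite /= odd_double /= uphalf_double doubleK; split.
rewrite /= !add0n odd_double /= uphalf_double doubleK dyadic_double; split=> //.
by have [] := sC k./2.
Qed.

Lemma scales : exists C : nat -> nat -> set B * set B,
  (forall n, scale n (C n)) /\ forall n k, C n.+1 k.*2 = C n k.
Proof.
have [C0 sC0] := scale0.
(* Dependent choice needs one type for all levels, so the level is packed with its scale. *)
pose X := {p : nat * (nat -> set B * set B) | scale p.1 p.2}.
pose step (p q : X) := (sval q).1 = (sval p).1.+1 /\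
  forall k, (sval q).2 k.*2 = (sval p).2 k.
have [|F [F0 FS]] := @dependent_choice X step _ (exist _ (0, C0) sC0).
  move=> [[n C] /= sC]; apply: cid.
  by have [D sD DC] := scaleS sC; exists (exist _ (n.+1, D) sD).
have F1 n : (sval (F n)).1 = n.
  by elim: n => [|n IH]; [rewrite F0|have [-> _] := FS n; rewrite IH].
exists (fun n => (sval (F n)).2); split=> [n|n k].
  by have := svalP (F n); rewrite {1}F1.
by have [_ ->] := FS n.
Qed.

Lemma extension : exists h : B -> R, [/\ continuous h,
  (forall b, -1 <= h b <= 1) & forall a, h (f a) = t a].
Proof.
have [C [sC CS]] := scales.
have cC n k : cut (dyadic R n k) (C n k) by have [] := sC n k.
have Cscale n m k : C (m + n)%N (2 ^ m * k)%N = C n k.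
  elim: m => [|m IH]; first by rewrite mul1n.
  by rewrite addSn expnS -mulnA mul2n CS.
have C1S n k b : (C n k).1 b -> (C n k.+1).1 b.
  move=> Cb; have [_ /(_ b)[//|Cb']] := sC n k.
  by have [_ _ /(_ _ Cb Cb')] := cC n k.
have C1_le n j k b : (j <= k)%N -> (C n j).1 b -> (C n k).1 b.
  by move=> /subnK <-; elim: (k - j)%N => // i IH /IH /C1S.
(* Both cuts are moved to the common level [m + n], where first components increase with the
   index. *)
have Cdisj n j m k b : dyadic R m k <= dyadic R n j ->
    (C m k).1 b -> (C n j).2 b -> False.
  rewrite -(dyadic_scale R m n k) -(dyadic_scale R n m j).
  rewrite -(Cscale m n k) -(Cscale n m j) addnC dyadic_le => /C1_le kj /kj.
  by have [_ _ H _ _] := cC (m + n)%N (2 ^ m * j)%N; exact: H.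
(* Adjoining 1 keeps the set nonempty and its infimum at most 1. *)
pose S b := [set r : R | r = 1 \/ exists n k, r = dyadic R n k /\ (C n k).1 b].
have S0 b : S b !=set0 by exists 1; left.
have dyadic_ge n k : -1 <= dyadic R n k.
  by rewrite /dyadic lerDl mulr_ge0 // divr_ge0 // exprn_ge0.
have SlbN1 b : lbound (S b) (-1).
  by move=> _ [->|[n [k [-> _]]]] //; lra.
have Slb b : has_lbound (S b) by exists (-1); exact: SlbN1.
pose h b := inf (S b).
have h1 b : h b <= 1 by apply: ge_inf => //; left.
have hN1 b : -1 <= h b by apply: lb_le_inf.
have hC1 n k b : (C n k).1 b -> h b <= dyadic R n k.
  by move=> Cb; apply: ge_inf => //; right; exists n, k.
have hC2 n k b : dyadic R n k <= 1 -> (C n k).2 b -> dyadic R n k <= h b.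
  move=> r1 Cb; apply: lb_le_inf => // _ [->//|[m [j [-> Cb']]]].
  by rewrite leNgt; apply/negP => /ltW /Cdisj; apply; eauto.
exists h; split=> [b|b|a]; last 2 first.
- by rewrite hN1 h1.
- apply/eqP; rewrite eq_le; apply/andP; split; last first.
    apply: lb_le_inf => // _ [->//|[n [k [-> Ck]]]].
    by have [_ _ _ /(_ a)[/(_ Ck) /ltW]] := cC n k.
  (* A dyadic strictly between [t a] and [h (f a)] has [f a] in its first open set, hence bounds
     [h (f a)] from above. *)
  rewrite leNgt; apply/negP => /(dyadic_dense (t_ge a))[n [k [tr rh]]].
  have := dyadic_ltS R n k => rr.
  have [_ _ _ /(_ a)[_ /(_ tr) /hC1]] := cC n k; lra.
apply/cvgrPdist_lt => e e0.
have near_lt : \forall b' \near b, h b' < h b + e.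
  have /(inf_lt (S0 b))[_ [->|[n [k [-> Cb]]]] rh] : inf (S b) < h b + e.
  - by rewrite -/(h b); lra.
  - by apply: nearW => b'; exact: le_lt_trans rh.
  - have [oC _ _ _ _] := cC n k.
    have : nbhs b (C n k).1 by apply: open_nbhs_nbhs.
    by apply: filterS => b' /hC1 /le_lt_trans; exact.
have near_gt : \forall b' \near b, h b - e < h b'.
  case: (ltP (h b - e) (-1)) => he.
    by apply: nearW => b'; exact: lt_le_trans he _.
  (* As [h b] exceeds the upper dyadic, [b] is outside the first set there; by nesting it lies in
     the second set of the lower one, a neighbourhood on which [h] exceeds [h b - e]. *)
  have [|n [k [er rh]]] := dyadic_dense he (y := h b); first by lra.
  have rr := dyadic_ltS R n k.
  have [_ oC _ _ _] := cC n k.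
  have Cb : (C n k).2 b.
    have [_ /(_ b)[/hC1|//]] := sC n k; lra.
  have : nbhs b (C n k).2 by apply: open_nbhs_nbhs.
  apply: filterS => b' /hC2 hC; apply: lt_le_trans er (hC _).
  have := h1 b; lra.
apply: filterS2 near_lt near_gt => b' lt gt.
by rewrite ltr_norml; apply/andP; split; lra.
Qed.

End Extension.

Theorem theorem3p11 (R : realType) :
  right_orth (left_orth M_Lambda_class) (to_point (segment R)).
Proof.
move=> A B f fP t s _.
have fL := fP _ _ _ M_Lambda_class_L.
have fM := fP _ _ _ M_Lambda_class_M.
have tP a : -1 <= \val (t a) <= 1 by have := set_valP (t a); rewrite /= in_itv.
(* The subspace topology is initial for [\val]; this gives continuity here and again for [g]. *)
have ct : continuous (fun a => \val (t a) : R).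
  move=> a; apply: continuous_comp; first exact: cts_fun.
  exact: initial_continuous.
have [h [ch hP hf]] := extension ct tP fL fM.
have hS b : h b \in (`[-1, 1]%classic : set R).
  by rewrite inE /= in_itv; exact: hP.
pose g b : segment R := exist _ (h b) (hS b).
have cg : continuous g by exact: continuous_comp_initial.
exists (mkcts cg); split; apply/funext => x.
- by apply: val_inj; exact: hf.
- by rewrite /=; case: (s x).
Qed.
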